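(* Let $n\ge1$, let $\boldsymbol{\alpha}\in\mathbb{R}^n$ be completely irrational, let $d\ge 1$ be real, and suppose that the Diophantine exponents of $\boldsymbol{\alpha}$ satisfy $$d<2\hat{\omega}(\boldsymbol{\alpha})-\omega(\boldsymbol{\alpha}).$$ Let $\boldsymbol{m}_\nu$, $M_\nu$, $\zeta_\nu$ ($\nu=1,2,3,\dots$) be the best approximation vectors of $\boldsymbol{\alpha}$ and the associated quantities, and define $$\underline{F}_\nu(\boldsymbol{x})=\frac{(\sin \pi(\boldsymbol{m}_\nu.\boldsymbol{x}))^2}{\zeta_\nu},\qquad \underline{f}_\nu(\boldsymbol{x})=\underline{F}_\nu(\boldsymbol{x}+\boldsymbol{\alpha})-\underline{F}_\nu(\boldsymbol{x}),\qquad \underline{f}(\boldsymbol{x})=\sum_{\nu=1}^\infty\frac{\underline{f}_\nu(\boldsymbol{x})}{M_\nu^d},\qquad \boldsymbol{x}\in\mathbb{R}^n .$$ Then $$S_{\underline{f}}^t(\boldsymbol{\alpha})=\sum_{k=0}^{t-1}\underline{f}(k\boldsymbol{\alpha})\to\infty\qquad\text{as } t\to\infty,\ t\in\mathbb{Z}_+ .$$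
   Context: A vector $\boldsymbol{\alpha}=(\alpha_1,\dots,\alpha_n)\in\mathbb{R}^n$ is completely irrational if $1,\alpha_1,\dots,\alpha_n$ are linearly independent over $\mathbb{Q}$. For vectors, $\boldsymbol{x}.\boldsymbol{m}=x_1m_1+\dots+x_nm_n$, and $\|y\|=\min_{a\in\mathbb{Z}}|y-a|$ for $y\in\mathbb{R}$. For completely irrational $\boldsymbol{\alpha}$ the irrationality measure function is $$\psi_{\boldsymbol{\alpha}}(t)=\min_{\boldsymbol{m}\in\mathbb{Z}^n:\,0<\max_j|m_j|\le t}\|\boldsymbol{\alpha}.\boldsymbol{m}\|,\qquad t\ge1 .$$ It is piecewise constant and non-increasing; it defines the sequence of best approximation vectors $\boldsymbol{m}_\nu=(m_{1,\nu},\dots,m_{n,\nu})\in\mathbb{Z}^n$, $\nu=1,2,\dots$, with $M_\nu=\max_{1\le j\le n}|m_{j,\nu}|$, $1=M_1<M_2<\cdots$, and $\zeta_\nu=\|\boldsymbol{\alpha}.\boldsymbol{m}_\nu\|$, $\zeta_1>\zeta_2>\cdots$, such that $\psi_{\boldsymbol{\alpha}}(t)=\zeta_\nu$ for $M_\nu\le t<M_{\nu+1}$. (Each $\boldsymbol{m}_\nu$ is determined up to sign, and the functions $\underline{F}_\nu$ do not depend on the choice of sign.) The ordinary Diophantine exponent is $$\omega(\boldsymbol{\alpha})=\sup\{\gamma\in\mathbb{R}:\ \liminf_{t\to\infty}t^\gamma\psi_{\boldsymbol{\alpha}}(t)<\infty\},$$ and the uniform Diophantine exponent is $$\hat{\omega}(\boldsymbol{\alpha})=\sup\{\gamma\in\mathbb{R}:\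 \limsup_{t\to\infty}t^\gamma\psi_{\boldsymbol{\alpha}}(t)<\infty\}.$$ The inequality $d<2\hat\omega(\boldsymbol\alpha)-\omega(\boldsymbol\alpha)$ is understood for finite exponents (so that the right-hand side is meaningful). *)

(* Defs.v *)
From HB Require Import structures.
From mathcomp Require Import all_boot all_order all_algebra.
From mathcomp Require Import all_classical all_reals all_analysis.

Set Implicit Arguments.
Unset Strict Implicit.
Unset Printing Implicit Defensive.

Import Order.TTheory GRing.Theory Num.Theory.
Import numFieldNormedType.Exports.

Local Open Scope classical_set_scope.
Local Open Scope ring_scope.

Definition completely_irrational (R : realType) (n : nat) (alpha : 'rV[R]_n) : Prop :=
  forall (q0 : rat) (q : 'rV[rat]_n),
    ratr q0 + \sum_(j < n) ratr (q 0 j) * alpha 0 j = 0 -> q0 = 0 /\ q = 0.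

Definition dotZ (R : realType) (n : nat) (x : 'rV[R]_n) (m : 'rV[int]_n) : R :=
  \sum_(j < n) x 0 j * (m 0 j)%:~R.

Definition height (n : nat) (m : 'rV[int]_n) : nat :=
  (\max_(j < n) `|m ord0 j|)%N.

(* The distance to the nearest integer; the infimum is attained. *)
Definition distZ (R : realType) (y : R) : R :=
  inf [set `|y - a%:~R| | a in [set: int]].

(* For 1 <= t and 0 < n the index set is finite and nonempty, so that this
   infimum is a minimum; other arguments are irrelevant. *)
Definition irr_fun (R : realType) (n : nat) (alpha : 'rV[R]_n) (t : R) : R :=
  inf [set distZ (dotZ alpha m) |
        m in [set m : 'rV[int]_n | (0 < height m)%N /\ (height m)%:R <= t]].

(* Indexing starts at 0: [m nu] is the (nu + 1)-st best approximation vector.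
   Each vector is only determined up to sign, hence a predicate on sequences. *)
Definition best_approximations (R : realType) (n : nat) (alpha : 'rV[R]_n)
    (m : nat -> 'rV[int]_n) : Prop :=
  [/\ height (m 0%N) = 1%N,
      forall nu, (height (m nu) < height (m nu.+1))%N,
      forall nu, distZ (dotZ alpha (m nu.+1)) < distZ (dotZ alpha (m nu)) &
      forall nu (t : R), (height (m nu))%:R <= t < (height (m nu.+1))%:R ->
        irr_fun alpha t = distZ (dotZ alpha (m nu))].

Definition ordinary_exponent (R : realType) (n : nat) (alpha : 'rV[R]_n) : \bar R :=
  ereal_sup [set gamma%:E | gamma in [set gamma : R |
    (limf_einf (fun t : R => (t `^ gamma * irr_fun alpha t)%:E) +oo_R < +oo)%E]].

Definition uniform_exponent (R : realType) (n : nat) (alpha : 'rV[R]_n) : \bar R :=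
  ereal_sup [set gamma%:E | gamma in [set gamma : R |
    (limf_esup (fun t : R => (t `^ gamma * irr_fun alpha t)%:E) +oo_R < +oo)%E]].

Definition F_term (R : realType) (n : nat) (alpha : 'rV[R]_n) (m : 'rV[int]_n)
    (x : 'rV[R]_n) : R :=
  sin (pi * dotZ x m) ^+ 2 / distZ (dotZ alpha m).

Definition f_term (R : realType) (n : nat) (alpha : 'rV[R]_n) (m : 'rV[int]_n)
    (x : 'rV[R]_n) : R :=
  F_term alpha m (x + alpha) - F_term alpha m x.

Definition f_series (R : realType) (n : nat) (alpha : 'rV[R]_n) (d : R)
    (m : nat -> 'rV[int]_n) (x : 'rV[R]_n) : R :=
  limn (series (fun nu => f_term alpha (m nu) x / (height (m nu))%:R `^ d)).

Definition birkhoff_sum (R : realType) (n : nat) (f : 'rV[R]_n -> R)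
    (alpha : 'rV[R]_n) (t : nat) : R :=
  \sum_(0 <= k < t) f (k%:R *: alpha).

(* Main.v *)
Require Import Defs.
From mathcomp Require Import all_boot all_order all_algebra.
From mathcomp Require Import all_classical all_reals all_analysis.
From mathcomp Require Import ring lra.
Import Order.TTheory GRing.Theory Num.Theory.
Import numFieldNormedType.Exports.
Local Open Scope classical_set_scope.
Local Open Scope ring_scope.

(** Write [M_nu] and [zeta_nu] for the height of the [nu]-th best approximation
vector [m_nu] and for the distance from [alpha.m_nu] to the nearest integer.

Since [f_nu (x) = F_nu (x + alpha) - F_nu x] and [F_nu 0 = 0], the Birkhoff sums
telescope term by term, and because [alpha.m_nu] is an integer plus or minus
[zeta_nu],
[[
  S_f^t (alpha) = \sum_nu sin (pi t zeta_nu)^2 / (zeta_nu M_nu^d),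
]]
a series of nonnegative terms ([birkhoff_sum_f_series], [F_term_multiple]).
Hence it is enough to find one large term for every large [t].

Choose reals [g] just below the uniform exponent and [h] above the ordinary one
with [2 g > d + h] ([exponents_gap]).  The definitions of the exponents give a
constant [C] with [zeta_nu <= C M_(nu+1)^(-g)] for all [nu], and
[zeta_nu >= M_nu^(-h)] for all large [nu] ([best_approximation_upper],
[best_approximation_lower]).  As the uniform exponent is at most the ordinary
one, [g] exceeds [d >= 1], and the first estimate makes the series converge:
its terms are at most a constant times
[1 / (M_nu M_(nu+1)) <= 1 / M_nu - 1 / M_(nu+1)] ([is_cvg_sin_series]).

Given [t], let [nu] be the least index with [pi t zeta_nu <= 1].  Then the sine
is comparable to its argument, and [pi t > 1 / zeta_(nu-1)], so the [nu]-th term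
is at least a positive constant times
[[
  t^2 zeta_nu / M_nu^d >= c zeta_nu / (zeta_(nu-1)^2 M_nu^d)
                       >= c' M_nu^(2 g - h - d).
]]
The exponent is positive and [nu] tends to infinity with [t], because every
[zeta_nu] is positive; so the right-hand side tends to infinity
([sin_sum_cvgy]). *)

(** * Diophantine exponents *)

(** A function with finite upper limit at infinity is eventually bounded above. *)
Lemma esup_pinfty_lt (R : realType) (f : R -> R) :
  (limf_esup (fun t => (f t)%:E) +oo_R < +oo)%E ->
  exists K : R, \forall t \near +oo_R, f t <= K.
Proof.
rewrite limf_esupE => /ereal_inf_lt [_ [V FV <-]].
case E: (ereal_sup _) => [K| |] // _.
- exists K; apply: filterS FV => t Vt.
  rewrite -lee_fin -E; apply: ereal_sup_ubound.
  by exists t.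
- exists 0; apply: filterS FV => t Vt.
  have : ((f t)%:E <= ereal_sup [set (f x)%:E | x in V])%E.
    by apply: ereal_sup_ubound; exists t.
  by rewrite E.
Qed.

(** A function with infinite lower limit at infinity eventually exceeds any [K]. *)
Lemma einf_pinfty_ge (R : realType) (f : R -> R) (K : R) :
  ~ (limf_einf (fun t => (f t)%:E) +oo_R < +oo)%E ->
  \forall t \near +oo_R, K <= f t.
Proof.
move=> /negP; rewrite -leNgt leye_eq => /eqP einfE.
have : (K%:E < limf_einf (fun t => (f t)%:E) +oo_R)%E by rewrite einfE ltry.
rewrite limf_einfE => /ereal_sup_gt [_ [V FV <-]] Klt.
apply: filterS FV => t Vt.
rewrite -lee_fin; apply: (le_trans (ltW Klt)); apply: ereal_inf_lbound.
by exists t.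
Qed.

Lemma uniform_le_ordinary (R : realType) (n : nat) (alpha : 'rV[R]_n) :
  (uniform_exponent alpha <= ordinary_exponent alpha)%E.
Proof.
apply: le_ereal_sup => _ [g /= esup_fin <-]; exists g => //=.
apply: contrapT => einfy.
have [K leK] := esup_pinfty_lt _ _ esup_fin.
have geK := einf_pinfty_ge _ _ (K + 1) einfy.
have [t [leKt geKt]] := filter_ex (filterI leK geK).
by have := le_trans geKt leKt; rewrite gerDl ler10.
Qed.

(** The gap [d < 2 u - o], where [u] and [o] are the uniform and the ordinary
exponents, leaves room for a real [g] slightly below [u] and a real [h] slightly
above [o] with [d + h < 2 * g]; that [1 <= g] follows from [u <= o]. *)
Lemma exponents_gap (R : realType) (n : nat) (alpha : 'rV[R]_n) (d : R) :
  1 <= d ->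
  ordinary_exponent alpha \is a fin_num ->
  uniform_exponent alpha \is a fin_num ->
  (d%:E < 2%:E * uniform_exponent alpha - ordinary_exponent alpha)%E ->
  exists g h : R, [/\ 1 <= g, d + h < 2 * g,
    exists K, \forall t \near +oo_R, t `^ g * irr_fun alpha t <= K &
    \forall t \near +oo_R, 1 <= t `^ h * irr_fun alpha t].
Proof.
move=> d1 ofin ufin dlt.
have uo := uniform_le_ordinary _ _ alpha.
set o := fine (ordinary_exponent alpha).
set u := fine (uniform_exponent alpha).
have oE : ordinary_exponent alpha = o%:E by rewrite fineK.
have uE : uniform_exponent alpha = u%:E by rewrite fineK.
rewrite oE uE lee_fin in uo.
rewrite oE uE -EFinM -EFinB lte_fin in dlt.
clear ofin ufin.
(* losing [e] at most three times keeps a margin of [e] *)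
pose e := (2 * u - o - d) / 4.
have e0 : 0 < e by rewrite /e; lra.
have [_ [g gU <-] ltg] : exists2 y, [set gamma%:E | gamma in [set gamma : R |
    (limf_esup (fun t : R => (t `^ gamma * irr_fun alpha t)%:E) +oo_R
      < +oo)%E]] y & ((u - e)%:E < y)%E.
  by apply: ereal_sup_gt; rewrite -/(uniform_exponent alpha) uE lte_fin; lra.
rewrite lte_fin in ltg.
exists g, (o + e); split; [by rewrite /e in e0 ltg *; lra
  | by rewrite /e in e0 ltg *; lra | exact: esup_pinfty_lt |].
apply: einf_pinfty_ge => einf_fin.
have : ((o + e)%:E <= ordinary_exponent alpha)%E.
  by apply: ereal_sup_ubound; exists (o + e).
by rewrite oE lee_fin; lra.
Qed.

(** * Distance to the nearest integer and sines *)

Lemma distZ_le (R : realType) (y : R) (a : int) : distZ y <= `|y - a%:~R|.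
Proof.
by apply: ge_inf; [exists 0 => _ [b _ <-] | exists a].
Qed.

Lemma distZ_ge0 (R : realType) (y : R) : 0 <= distZ y.
Proof.
apply: lb_le_inf; first by exists `|y - 0%:~R|; exists 0.
by move=> _ [b _ <-].
Qed.

Lemma distZ_attained (R : realType) (y : R) :
  exists a : int, distZ y = `|y - a%:~R|.
Proof.
have [a ale] : exists a : int, `|y - a%:~R| <= 1 / 2.
  have /andP[lo hi] := floor_itv y.
  rewrite intrD in hi.
  have [le2|lt2] := leP (y - (Num.floor y)%:~R) (1 / 2).
    by exists (Num.floor y); rewrite ler_norml; apply/andP; split; lra.
  by exists (Num.floor y + 1); rewrite intrD ler_norml; apply/andP; split; lra.
exists a; apply/le_anti; rewrite distZ_le /=.
apply: lb_le_inf; first by exists `|y - 0%:~R|; exists 0.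
move=> _ [b _ <-]; have [->//|neq] := eqVneq b a.
have : (1 : R) <= `|b%:~R - a%:~R|.
  rewrite -intrB -intr_norm -[1]/(1%:~R) ler_int -gtz0_ge1.
  by rewrite normr_gt0 subr_eq0.
have := ler_distD y (b%:~R : R) a%:~R.
rewrite (distrC _ y); move: ale; lra.
Qed.

Lemma sin_sqrDpin (R : realType) (x : R) (k : nat) :
  sin (x + pi * k%:R) ^+ 2 = sin x ^+ 2.
Proof.
elim: k => [|k IH]; first by rewrite mulr0 addr0.
rewrite -IH -natr1 mulrDr mulr1 addrA.
by have /= -> := sinDpi (x + pi * k%:R); rewrite sqrrN.
Qed.

Lemma sin_sqrDpiz (R : realType) (x : R) (a : int) :
  sin (x + pi * a%:~R) ^+ 2 = sin x ^+ 2.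
Proof.
case: a => k; first exact: sin_sqrDpin.
rewrite NegzE -[LHS](sin_sqrDpin _ _ k.+1); congr (sin _ ^+ 2).
by rewrite mulrNz mulrN -addrA addNr addr0.
Qed.

Lemma sin_sqr_distZ (R : realType) (y : R) (k : nat) :
  sin (pi * (k%:R * y)) ^+ 2 = sin (pi * (k%:R * distZ y)) ^+ 2.
Proof.
have [a ->] := distZ_attained _ y.
rewrite -[LHS](sin_sqrDpiz _ _ (- (k%:Z * a))) mulrNz intrM /=.
have -> : pi * (k%:R * y) + pi * - (k%:~R * a%:~R) =
          pi * (k%:R * (y - a%:~R)) :> R by ring.
have [ge0|lt0] := leP 0 (y - a%:~R); first by rewrite ger0_norm.
by rewrite ltr0_norm // 2!mulrN sinN sqrrN.
Qed.

Lemma sin_mean_value (R : realType) (x : R) : 0 <= x ->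
  exists2 c, 0 <= c <= x & sin x = cos c * x.
Proof.
move=> x0; have contsin : {within `[0, x], continuous (@sin R)}.
  by apply: continuous_subspaceT; exact: continuous_sin.
have [c cx] := MVT_segment x0 (fun z _ => is_derive_sin z) contsin.
by rewrite sin0 !subr0 => ->; exists c.
Qed.

Lemma sin_sqr_le (R : realType) (x : R) : 0 <= x -> sin x ^+ 2 <= x ^+ 2.
Proof.
by move=> /sin_mean_value [c _ ->]; rewrite exprMn ler_piMl ?sqr_ge0 //.
Qed.

(** The constant [cos 1 ^+ 2] comes from the mean value theorem, [cos] being
decreasing on [[0, 1]]. *)
Lemma sin_sqr_ge (R : realType) (x : R) : 0 <= x <= 1 ->
  cos 1 ^+ 2 * x ^+ 2 <= sin x ^+ 2.
Proof.
move=> /andP[x0 x1]; have [c /andP[c0 cx] ->] := sin_mean_value _ _ x0.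
rewrite exprMn ler_wpM2r ?sqr_ge0 // lerXn2r ?nnegrE ?(ltW (cos1_gt0 _)) //.
  apply: cos_ge0_pihalf; have := pihalf_ge1 R; lra.
have pi2 := pi_ge2 R.
have [->//|c1] := eqVneq c 1.
by apply: ltW; rewrite ltr_cos ?in_itv /=; lra.
Qed.

(** * The series of squared sines *)

(** The terms are dominated by a telescoping series: [sin x ^+ 2 <= x ^+ 2] bounds
them by a multiple of [zeta nu / M nu], and [M nu.+1 - M nu >= 1] turns
[1 / (M nu * M nu.+1)] into a difference of inverses. *)
Lemma is_cvg_sin_series (R : realType) (d g C : R) (M zeta : R^nat) (t : nat) :
  1 <= d -> 1 <= g ->
  (forall nu, 1 <= M nu) ->
  (forall nu, M nu + 1 <= M nu.+1) ->
  (forall nu, 0 < zeta nu) ->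
  (forall nu, zeta nu * M nu.+1 `^ g <= C) ->
  cvgn (series (fun nu =>
    sin (pi * (t%:R * zeta nu)) ^+ 2 / zeta nu / M nu `^ d)).
Proof.
move=> d1 g1 M1 MS zeta0 zetaC.
set u := fun nu => _.
have M0 nu : 0 < M nu by apply: lt_le_trans (M1 nu).
have u_ge0 nu : 0 <= u nu.
  by rewrite /u divr_ge0 ?powR_ge0 // divr_ge0 ?sqr_ge0 // ltW.
have C0 : 0 <= C by rewrite (le_trans _ (zetaC 0%N)) // mulr_ge0 ?powR_ge0 ?ltW.
pose B := (pi * t%:R) ^+ 2 * C.
have B0 : 0 <= B by rewrite mulr_ge0 ?sqr_ge0.
have u_le nu : u nu <= B * ((M nu)^-1 - (M nu.+1)^-1).
  have ule : u nu <= (pi * t%:R) ^+ 2 * (zeta nu / M nu).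
    have sle : sin (pi * (t%:R * zeta nu)) ^+ 2 / zeta nu
               <= (pi * t%:R) ^+ 2 * zeta nu.
      rewrite ler_pdivrMr // -mulrA -expr2 -exprMn -mulrA.
      by apply: sin_sqr_le; rewrite !mulr_ge0 ?pi_ge0 // ltW.
    rewrite /u [leRHS]mulrA; apply: ler_pM => //.
    - by rewrite mulr_ge0 ?sqr_ge0 ?invr_ge0 // ltW.
    - by rewrite invr_ge0 powR_ge0.
    - by rewrite lef_pV2 ?posrE ?powR_gt0 // le1r_powR.
  apply: (le_trans ule); rewrite /B -mulrA ler_wpM2l ?sqr_ge0 //.
  have zle : zeta nu <= C / M nu.+1.
    rewrite ler_pdivlMr // (le_trans _ (zetaC nu)) // ler_pM2l //.
    by rewrite le1r_powR.
  apply: (@le_trans _ _ (C / M nu.+1 / M nu)).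
    by rewrite ler_pM2r ?invr_gt0.
  rewrite -mulrA ler_wpM2l //.
  have -> : (M nu)^-1 - (M nu.+1)^-1 = (M nu.+1 - M nu) / (M nu.+1 * M nu).
    by field; rewrite !gt_eqF.
  rewrite -invfM ler_pMl ?invr_gt0 ?mulr_gt0 //.
  by rewrite lerBrDr addrC.
apply: nondecreasing_is_cvgn; first exact: nondecreasing_series.
exists B => _ [N _ <-].
apply: (@le_trans _ _ (\sum_(0 <= i < N) - (B * (M i.+1)^-1 - B * (M i)^-1))).
  apply: ler_sum => i _; apply: (le_trans (u_le i)).
  by rewrite mulrBr opprB.
rewrite sumrN telescope_sumr // opprB lerBlDr.
have M0' : B * (M 0%N)^-1 <= B by rewrite ler_piMr // invf_le1.
by rewrite (le_trans M0') // lerDl mulr_ge0 // invr_ge0 ltW.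
Qed.

(** The growth of the Birkhoff sums, in terms of the two real sequences of heights
and distances only: for each large [t] a single term of the series is large. *)
Lemma sin_sum_cvgy (R : realType) (d g h C : R) (M zeta : R^nat) :
  1 <= d -> 1 <= g -> d + h < 2 * g ->
  (forall nu, 1 <= M nu) ->
  (forall nu, M nu + 1 <= M nu.+1) ->
  (forall nu, 0 < zeta nu) ->
  (forall nu, zeta nu.+1 < zeta nu) ->
  (forall nu, zeta nu * M nu.+1 `^ g <= C) ->
  (\forall nu \near \oo, 1 <= M nu `^ h * zeta nu) ->
  limn (series (fun nu =>
    sin (pi * (t%:R * zeta nu)) ^+ 2 / zeta nu / M nu `^ d)) @[t --> \oo] --> +oo.
Proof.
move=> d1 g1 gap M1 MS zeta0 zetaS zetaC zetah.
pose u t nu := sin (pi * (t%:R * zeta nu)) ^+ 2 / zeta nu / M nu `^ d.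
have M0 nu : 0 < M nu by apply: lt_le_trans (M1 nu).
have u_ge0 t nu : 0 <= u t nu.
  by rewrite /u divr_ge0 ?powR_ge0 // divr_ge0 ?sqr_ge0 // ltW.
have u_le_lim t nu : u t nu <= limn (series (u t)).
  have nd : nondecreasing_seq (series (u t)) by exact: nondecreasing_series.
  have cv : cvgn (series (u t)) by exact: (@is_cvg_sin_series _ d g C).
  apply: (le_trans _ (nondecreasing_cvgn_le nd cv nu.+1)).
  by rewrite seriesEnat /= big_nat_recr //= lerDr sumr_ge0.
have M_ge nu : nu%:R <= M nu.
  elim: nu => [|nu IH]; first exact: ltW.
  by rewrite -natr1 (le_trans _ (MS nu)) // lerD2r.
have zeta_noninc : nonincreasing_seq zeta.
  by apply/nonincreasing_seqP => k; exact: ltW.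
have C0 : 0 < C by rewrite (lt_le_trans _ (zetaC 0%N)) // mulr_gt0 ?powR_gt0.
have c0 : 0 < cos 1 ^+ 2 :> R by rewrite exprn_gt0 ?cos1_gt0.
pose e := 2 * g - (d + h).
have e0 : 0 < e by rewrite subr_gt0.
apply/cvgryPge => A.
(* the chosen term is at least [cos 1 ^+ 2 / C ^+ 2 * M nu `^ e], hence at
   least [A] once [M nu `^ e >= B] *)
pose B := Num.max 1 (A * C ^+ 2 / cos 1 ^+ 2).
have B0 : 0 < B by rewrite lt_max ltr01.
have [N _ NP] : \forall nu \near \oo, 1 <= M nu `^ h * zeta nu /\ B <= M nu `^ e.
  apply: filterS2 zetah (nbhs_infty_ger (B `^ e^-1)) => nu hnu Bnu; split=> //.
  rewrite -[leLHS](powRr1 (ltW B0)) -(mulVf (lt0r_neq0 e0)) powRrM.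
  by rewrite ge0_ler_powR ?nnegrE ?powR_ge0 ?(ltW e0) ?(ltW (M0 _)) //
    (le_trans Bnu).
have := nbhs_infty_gtr (pi * zeta N)^-1.
apply: filterS => t t_gt.
have pz0 nu : 0 < pi * zeta nu by rewrite mulr_gt0 ?pi_gt0.
have small_ex : exists nu, pi * (t%:R * zeta nu) <= 1.
  have [nu _ /(_ nu (leqnn nu)) nuP] := nbhs_infty_ger (pi * t%:R * C).
  exists nu.
  have nuM : pi * t%:R * C <= M nu.+1.
    by rewrite (le_trans nuP) // (le_trans (M_ge nu)) // (le_trans _ (MS nu)) ?lerDl.
  rewrite -(ler_pM2r (M0 nu.+1)) mul1r (le_trans _ nuM) //.
  rewrite [pi * (_ * _)]mulrA -[_ * zeta nu * _]mulrA ler_wpM2l //.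
    by rewrite mulr_ge0 ?pi_ge0.
  by rewrite (le_trans _ (zetaC nu)) // ler_pM2l // le1r_powR.
(* the least index [v] at which the sine is in its linear range *)
case: (ex_minnP small_ex) => v v_small v_min.
have N_lt_v : (N < v)%N.
  rewrite ltnNge; apply/negP => /zeta_noninc zNv.
  have : 1 < pi * (t%:R * zeta N) by rewrite mulrCA -ltr_pdivrMr // div1r.
  apply/negP; rewrite -leNgt (le_trans _ v_small) //.
  by rewrite ler_wpM2l ?pi_ge0 // ler_wpM2l.
case: v => // w in v_small v_min N_lt_v *.
(* minimality of [v = w.+1] makes the previous distance large *)
have w_big : 1 < pi * t%:R * zeta w.
  rewrite ltNge -mulrA; apply/negP => /v_min.
  by rewrite ltnn.
have [hz Be] := NP _ (ltnW N_lt_v).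
apply: (le_trans _ (u_le_lim t w.+1)).
set s := pi * t%:R in w_big.
set z := zeta w.+1 in hz *.
have z0 : 0 < z by exact: zeta0.
have singe : cos 1 ^+ 2 * (s * z) ^+ 2 <= sin (pi * (t%:R * z)) ^+ 2.
  by rewrite /s -[_ * t%:R * z]mulrA sin_sqr_ge // v_small andbT !mulr_ge0 ?pi_ge0 // ltW.
have s0 : 0 <= s by rewrite mulr_ge0 ?pi_ge0.
rewrite /u -/z ler_pdivlMr ?powR_gt0 // ler_pdivlMr // (le_trans _ singe) //.
have -> : cos 1 ^+ 2 * (s * z) ^+ 2 = cos 1 ^+ 2 * s ^+ 2 * z * z by ring.
rewrite ler_pM2r //.
set P := M w.+1 `^ g; set D := M w.+1 `^ d; set H := M w.+1 `^ h in hz.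
set E := M w.+1 `^ e in Be.
have D0 : 0 < D by exact: powR_gt0.
have P0 : 0 < P by exact: powR_gt0.
have PE : P ^+ 2 = E * (D * H).
  rewrite /P /E /D /H expr2 -!powRD ?(gt_eqF (M0 _)) ?implybT //.
  by congr (_ `^ _); rewrite /e; ring.
have PsC : P <= s * C.
  have := ltW w_big; rewrite -(ler_pM2r P0) mul1r => /le_trans; apply.
  by rewrite -mulrA ler_wpM2l.
have AE : A * C ^+ 2 <= cos 1 ^+ 2 * E.
  rewrite -ler_pdivrMl // mulrC (le_trans _ Be) //.
  by rewrite le_max lexx orbT.
rewrite -(ler_pM2r (exprn_gt0 2 C0)).
apply: (@le_trans _ _ (cos 1 ^+ 2 * P ^+ 2 * z)); last first.
  have -> : cos 1 ^+ 2 * s ^+ 2 * z * C ^+ 2 = cos 1 ^+ 2 * (s * C) ^+ 2 * z.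
    by ring.
  rewrite ler_pM2r // ler_pM2l //.
  by rewrite lerXn2r ?nnegrE ?(ltW P0) ?mulr_ge0 ?pi_ge0 ?(ltW C0).
rewrite PE.
have -> : cos 1 ^+ 2 * (E * (D * H)) * z = cos 1 ^+ 2 * E * D * (H * z) by ring.
have -> : A * D * C ^+ 2 = A * C ^+ 2 * D by ring.
apply: (@le_trans _ _ (cos 1 ^+ 2 * E * D)); first by rewrite ler_pM2r.
by rewrite ler_peMr // mulr_ge0 ?(ltW D0) // mulr_ge0 ?powR_ge0 ?(ltW c0).
Qed.

(** * Telescoping of the Birkhoff sums *)

Lemma F_term_multiple (R : realType) (n : nat) (alpha : 'rV[R]_n)
    (m : 'rV[int]_n) (t : nat) :
  F_term alpha m (t%:R *: alpha) =
  sin (pi * (t%:R * distZ (dotZ alpha m))) ^+ 2 / distZ (dotZ alpha m).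
Proof.
rewrite /F_term -sin_sqr_distZ; congr (sin (pi * _) ^+ 2 / _).
by rewrite /dotZ mulr_sumr; apply: eq_bigr => j _; rewrite mxE mulrA.
Qed.

(** Summability of the series of the [F_term]s is what allows the limit of a
difference to be split; the sum telescopes, and the series at the origin is
zero. *)
Lemma birkhoff_sum_f_series (R : realType) (n : nat) (alpha : 'rV[R]_n) (d : R)
    (m : nat -> 'rV[int]_n) (t : nat) :
  (forall k : nat, cvgn (series (fun nu =>
     F_term alpha (m nu) (k%:R *: alpha) / (height (m nu))%:R `^ d))) ->
  birkhoff_sum (f_series alpha d m) alpha t =
  limn (series (fun nu =>
     F_term alpha (m nu) (t%:R *: alpha) / (height (m nu))%:R `^ d)).
Proof.
move=> cv.
pose G k := limn (series (fun nu =>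
  F_term alpha (m nu) (k%:R *: alpha) / (height (m nu))%:R `^ d)).
have fG k : f_series alpha d m (k%:R *: alpha) = G k.+1 - G k.
  rewrite /G -limB // /f_series; congr (limn _); apply/funext => N.
  rewrite !seriesEnat /= fctE -sumrB; apply: eq_bigr => nu _.
  by rewrite -natr1 scalerDl scale1r -[RHS]mulrBl.
rewrite /birkhoff_sum (eq_bigr _ (fun k _ => fG k)) telescope_sumr // -/(G t).
suff -> : G 0%N = 0 by rewrite subr0.
rewrite /G; apply/cvg_lim => //.
rewrite (_ : series _ = cst 0); first exact: cvg_cst.
apply/funext => N; rewrite seriesEnat /= big1 // => nu _.
by rewrite F_term_multiple mul0r mulr0 sin0 expr0n /= !mul0r.
Qed.

(** * Estimates on best approximations *)

(** The best approximation function is constant on [height (m nu) <= t < height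
(m nu.+1)], so its decay rate can be tested at the midpoint of this
plateau, which is at least half of the right end.
The finitely many indices with small heights are absorbed in the constant. *)
Lemma best_approximation_upper (R : realType) (n : nat) (alpha : 'rV[R]_n)
    (m : nat -> 'rV[int]_n) (g : R) :
  0 <= g -> best_approximations alpha m ->
  (exists K, \forall t \near +oo_R, t `^ g * irr_fun alpha t <= K) ->
  exists C, forall nu,
    distZ (dotZ alpha (m nu)) * (height (m nu.+1))%:R `^ g <= C.
Proof.
move=> g0 [h0 hS zS irrE] [K [T [_ KP]]].
pose zeta nu := distZ (dotZ alpha (m nu)).
pose T1 := 2 * Num.max T 0.
exists (Num.max (2 `^ g * K) (zeta 0%N * T1 `^ g)) => nu.
rewrite -/(zeta nu) le_max.
set M1 : R := (height (m nu.+1))%:R; set M0 : R := (height (m nu))%:R.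
have M00 : 0 <= M0 by [].
have M01 : M0 < M1 by rewrite ltr_nat.
have [small|large] := leP M1 T1.
  apply/orP; right.
  have zle : zeta nu <= zeta 0%N.
    have noninc : nonincreasing_seq zeta.
      by apply/nonincreasing_seqP => k; exact: ltW (zS k).
    exact: noninc.
  rewrite ler_pM ?distZ_ge0 ?powR_ge0 // ge0_ler_powR // nnegrE.
    exact: ltW (le_lt_trans M00 M01).
  by rewrite (le_trans _ small) // ltW // (le_lt_trans M00 M01).
apply/orP; left.
pose t := (M0 + M1) / 2.
have Tt : T < t.
  have : T <= Num.max T 0 by rewrite le_max lexx.
  by rewrite /t /T1 in large *; lra.
have := KP _ Tt.
rewrite (irrE nu) -/(zeta nu); last by rewrite -/M0 -/M1 /t; lra.
move=> zK.
have M1t : M1 <= 2 * t by rewrite /t; lra.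
have M1g : M1 `^ g <= 2 `^ g * t `^ g.
  have t0 : 0 <= t by rewrite /t; lra.
  by rewrite -powRM // ge0_ler_powR ?nnegrE // mulr_ge0.
apply: (@le_trans _ _ (2 `^ g * (t `^ g * zeta nu))).
  by rewrite mulrA mulrC ler_wpM2r ?distZ_ge0.
by rewrite ler_wpM2l ?powR_ge0.
Qed.

Lemma best_approximation_lower (R : realType) (n : nat) (alpha : 'rV[R]_n)
    (m : nat -> 'rV[int]_n) (h : R) :
  best_approximations alpha m ->
  (\forall t \near +oo_R, 1 <= t `^ h * irr_fun alpha t) ->
  \forall nu \near \oo,
    1 <= (height (m nu))%:R `^ h * distZ (dotZ alpha (m nu)).
Proof.
move=> [h0 hS zS irrE] [T [_ TP]].
have M_ge nu : (nu <= height (m nu))%N.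
  by elim: nu => // nu IH; exact: leq_ltn_trans (hS nu).
apply: filterS (nbhs_infty_gtr T) => nu Tnu.
have := TP (height (m nu))%:R; rewrite (irrE nu); first apply.
  by rewrite (lt_le_trans Tnu) // ler_nat.
by rewrite lexx ltr_nat hS.
Qed.

(** * Divergence of the Birkhoff sums *)

Theorem theorem4 (R : realType) (n : nat) (alpha : 'rV[R]_n) (d : R)
    (m : nat -> 'rV[int]_n) :
  (1 <= n)%N ->
  completely_irrational alpha ->
  1 <= d ->
  ordinary_exponent alpha \is a fin_num ->
  uniform_exponent alpha \is a fin_num ->
  (d%:E < 2%:E * uniform_exponent alpha - ordinary_exponent alpha)%E ->
  best_approximations alpha m ->
  birkhoff_sum (f_series alpha d m) alpha t @[t --> \oo] --> +oo.
Proof.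
move=> _ _ d1 ofin ufin dlt best.
have [g [h [g1 gap upper lower]]] := exponents_gap _ _ alpha d d1 ofin ufin dlt.
have [C zetaC] := best_approximation_upper _ _ _ _ _ (le_trans ler01 g1) best upper.
have zetah := best_approximation_lower _ _ _ _ _ best lower.
have [h0 hS zS _] := best.
pose zeta nu := distZ (dotZ alpha (m nu)).
pose M nu : R := (height (m nu))%:R.
have zeta0 nu : 0 < zeta nu by exact: le_lt_trans (distZ_ge0 _ _) (zS nu).
have M1 nu : 1 <= M nu.
  by rewrite ler1n; case: nu => [|nu]; [rewrite h0 | exact: leq_ltn_trans (hS nu)].
have MS nu : M nu + 1 <= M nu.+1 by rewrite natr1 ler_nat.
have termE t : (fun nu => F_term alpha (m nu) (t%:R *: alpha) / M nu `^ d) =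
    fun nu => sin (pi * (t%:R * zeta nu)) ^+ 2 / zeta nu / M nu `^ d.
  by apply/funext => nu; rewrite F_term_multiple.
rewrite (_ : birkhoff_sum _ _ = fun t => limn (series (fun nu =>
    sin (pi * (t%:R * zeta nu)) ^+ 2 / zeta nu / M nu `^ d))).
  exact: (sin_sum_cvgy _ d g h C).
apply/funext => t; rewrite birkhoff_sum_f_series ?termE // => k.
by rewrite termE; exact: (is_cvg_sin_series _ d g C).
Qed.
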